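(* Let $G = K \rtimes_\varphi \langle t\rangle$ be a finitely generated group, where $K$ is abelian, $\langle t\rangle$ is infinite cyclic and $\varphi\in\mathrm{Aut}(K)$, and suppose $G$ has exponential growth. Let $R$ be a finite symmetric subset of $K$ such that $S=\{(r,1),(0,t^{\pm1}) : r\in R\}$ generates $G$. Then $$\frac{c(S^r)}{|S^r|}=O\!\left(\frac{\log r}{r}\right)\quad (r\to\infty).$$
   Context: $K$ is written additively; elements of $G$ are pairs $(k,t^m)$ with $k\in K$, $m\in\mathbb Z$, with multiplication $(k,t^m)(k',t^{m'})=(k+\varphi^m(k'),t^{m+m'})$, so that $t k t^{-1}=\varphi(k)$; we identify $k$ with $(k,1)$ and $t^m$ with $(0,t^m)$. For a finite symmetric generating set $S$, $S^r$ denotes the set of elements of $G$ of word length at most $r$ with respect to $S$ (the ball of radius $r$). For a subset $A\subseteq G$, $c(A)$ denotes the number of distinct conjugacy classes of $G$ that meet $A$. *)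

(* Defs.v *)
From HB Require Import structures.
From mathcomp Require Import all_boot all_order all_algebra.
From mathcomp Require Import reals exp.
Set Implicit Arguments. Unset Strict Implicit. Unset Printing Implicit Defensive.
Import Order.TTheory GRing.Theory Num.Theory.
Local Open Scope ring_scope.

(* The semidirect product G = K x|_phi <t>, elements (k, m) standing for (k, t^m).
   psi is the inverse of the automorphism phi. *)

Definition phipow (K : zmodType) (phi psi : K -> K) (m : int) : K -> K :=
  match m with
  | Posz n => iter n phi
  | Negz n => iter n.+1 psi
  end.

Definition gmul (K : zmodType) (phi psi : K -> K) (x y : (K * int)%type)
  : (K * int)%type :=
  (x.1 + phipow phi psi x.2 y.1, x.2 + y.2).

Definition gone (K : zmodType) : (K * int)%type := (0, 0).

Definition gens (K : zmodType) (Rs : seq K) : seq (K * int)%type :=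
  [seq (r, 0%R) | r <- Rs] ++ [:: ((0 : K), 1%R); ((0 : K), (-1)%R)].

Definition ball (K : zmodType) (phi psi : K -> K) (S : seq (K * int)%type) (n : nat)
  : seq (K * int)%type :=
  iter n (fun B => undup (B ++ [seq gmul phi psi x s | x <- B, s <- S])) [:: gone K].

Definition gconj (K : zmodType) (phi psi : K -> K) (x y : (K * int)%type) : Prop :=
  exists g, gmul phi psi g x = gmul phi psi y g.

(* c(A) = n : the number of distinct conjugacy classes of G meeting A is n,
   witnessed by a system T of representatives (elements of A, pairwise
   non-conjugate, every element of A conjugate to one of them). *)
Definition num_classes (K : zmodType) (phi psi : K -> K) (A : seq (K * int)%type)
  (n : nat) : Prop :=
  exists T : seq (K * int)%type,
    [/\ size T = n,
        {subset T <= A},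
        (forall i j, (i < size T)%N -> (j < size T)%N ->
           gconj phi psi (nth (gone K) T i) (nth (gone K) T j) -> i = j)
      & (forall a, a \in A -> exists2 t, t \in T & gconj phi psi a t)].

Definition exp_growth (R : realType) (K : zmodType) (phi psi : K -> K)
  (S : seq (K * int)%type) : Prop :=
  exists2 c : R, 1 < c &
    exists N : nat, forall n : nat, (N <= n)%N -> c ^+ n <= (size (ball phi psi S n))%:R.

(* Main.v *)
Require Import Defs.
From HB Require Import structures.
From mathcomp Require Import all_boot all_order all_algebra.
From mathcomp Require Import boolp reals sequences exp.
From mathcomp Require Import zify ring lra.
Set Implicit Arguments. Unset Strict Implicit. Unset Printing Implicit Defensive.
Import Order.TTheory GRing.Theory Num.Theory.
Local Open Scope ring_scope.

(* The classes of words of length r are counted through walks: the powers of t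
   occurring in a word trace the positions of a cursor on Z.  Words whose cursor stays
   in [-r/M, r/M] represent exponentially few elements, by a count of multisets.
   Otherwise the word w has more than r/M rotations starting at different positions,
   all of length r and conjugate to w.  If at most two of them coincide at a time, the
   class has at least r/(2M) elements in the ball, and the number of such classes is
   O(|S^r| / r).  If three coincide, some rotation of w is a product of two commuting
   words x, y of total length at most r, both of nonzero exponent; one of them, say x,
   has length at most r/2, and y lies in its centralizer, which meets S^r in
   polynomially many elements because K is a Noetherian Z[t, t^-1]-module: all Fix(phi^e) lie in a single
   Fix(phi^J), and this embeds in K / (phi^J - 1)^a K, on which phi acts
   quasi-unipotently.  As |S^(r/2)| is close to |S^r|^(1/2) up to a small exponential
   (Fekete), these classes are exponentially few as well.  The bound obtained is
   O(1/r). *)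

(** * Ascending chains of subgroups of the integers *)

Section SubgroupChains.

Lemma homo_chain (T : Type) (M : nat -> T -> Prop) :
  (forall i x, M i x -> M i.+1 x) -> forall i j x, (i <= j)%N -> M i x -> M j x.
Proof.
move=> Mi i j x; elim: j => [|j IH]; first by rewrite leqn0 => /eqP->.
by rewrite leq_eqVlt => /predU1P[->//|/IH H /H/Mi].
Qed.

Lemma subgroupMz (A : zmodType) (P : A -> Prop) : P 0 ->
  (forall x y, P x -> P y -> P (x - y)) -> forall x (z : int), P x -> P (x *~ z).
Proof.
move=> P0 PB x z Px.
have PN y : P y -> P (- y) by move=> Py; rewrite -sub0r; exact: PB.
have Pn n : P (x *+ n).
  elim: n => [|n IH]; first by rewrite mulr0n.
  by rewrite mulrSr -[x in _ + x]opprK; apply: PB => //; exact: PN.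
by case: z => n; rewrite ?NegzE ?mulrNz -pmulrn; [exact: Pn|exact/PN/Pn].
Qed.

(** Once a term of the chain contains the least positive element of the union, Euclidean division
    puts the whole union in that term; without positive elements the union is zero. *)
Lemma int_chain (L : nat -> int -> Prop) : (forall i, L i 0) ->
  (forall i a b, L i a -> L i b -> L i (a - b)) ->
  (forall i a, L i a -> L i.+1 a) ->
  exists N, forall i a, L i a -> L N a.
Proof.
move=> L0 LB LS.
have [[n /asboolP[i Li]]|Lz] :=
    pselect (exists n, `[< exists i, L i n.+1%:Z >]); last first.
  exists 0%N => i [[|n]|n] Lia //; exfalso; apply: Lz; exists n; apply/asboolP;
    exists i => //.
  by rewrite -[n.+1%:Z]opprK -NegzE -sub0r; exact: LB.
have exP : exists n, `[< exists i, L i n.+1%:Z >].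
  by exists n; apply/asboolP; exists i.
case: (ex_minnP exP) => d /asboolP[j Lj] dmin.
exists j => k a Lka.
pose m := maxn j k.
have Lma : L m a by apply: homo_chain Lka => //; rewrite leq_maxr.
have Lmd : L m d.+1%:Z by apply: homo_chain Lj => //; rewrite leq_maxl.
have Lmr : L m (a %% d.+1%:Z)%Z.
  rewrite /modz; apply: (LB) => //.
  rewrite mulrC -mulrzz; exact: (subgroupMz (L0 m) (@LB m)).
have a_mod : (a %% d.+1%:Z)%Z = 0.
  have := ltz_pmod a (isT : (0 : int) < d.+1%:Z).
  have := modz_ge0 a (isT : d.+1%:Z != 0).
  case: (a %% d.+1%:Z)%Z Lmr => // -[//|r] Lr _; rewrite ltz_nat => rd.
  have : (d <= r)%N by apply: dmin; apply/asboolP; exists m.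
  by lia.
have -> : a = d.+1%:Z *~ (a %/ d.+1%:Z)%Z.
  by rewrite {1}(divz_eq a d.+1%:Z) a_mod addr0 mulrC mulrzz.
exact: (subgroupMz (L0 j) (@LB j)).
Qed.

(** The diagonal [L i i] is constant from some [N0] on, which settles every [d] at least [N0]; the
    smaller [d] give finitely many single chains. *)
Lemma int_chain2 (L : nat -> nat -> int -> Prop) : (forall i d, L i d 0) ->
  (forall i d a b, L i d a -> L i d b -> L i d (a - b)) ->
  (forall i d a, L i d a -> L i.+1 d a) ->
  (forall i d a, L i d a -> L i d.+1 a) ->
  exists N, forall i d a, L i d a -> L N d a.
Proof.
move=> L0 LB LSi LSd.
have Li i j d a : (i <= j)%N -> L i d a -> L j d a.
  by apply: (@homo_chain _ (fun i => L i d)) => k x; exact: LSi.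
have Ld i d d' a : (d <= d')%N -> L i d a -> L i d' a.
  by apply: homo_chain => k x; exact: LSd.
have [N0 N0P] : exists N, forall i a, L i i a -> L N N a.
  apply: (@int_chain (fun i => L i i)) => [i|i a b|i a /LSi/LSd//].
    exact: L0.
  exact: LB.
have [N1 N1P] : exists N, forall d, (d < N0)%N -> forall i a, L i d a -> L N d a.
  elim: N0 {N0P} => [|n [N IH]]; first by exists 0%N.
  have [N' N'P] : exists N, forall i a, L i n a -> L N n a.
    apply: (@int_chain (fun i => L i n)) => [i|i a b|i a].
    - exact: L0.
    - exact: LB.
    - exact: LSi.
  exists (maxn N N') => d; rewrite ltnS leq_eqVlt => /predU1P[->|dn] i a Lia.
    by apply: (@Li N'); [exact: leq_maxr|exact: N'P Lia].
  by apply: (@Li N); [exact: leq_maxl|exact: IH Lia].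
exists (maxn N0 N1) => i d a Lia.
have [dN|Nd] := ltnP d N0.
  by apply: (@Li N1); [exact: leq_maxr|exact: N1P Lia].
apply: (@Li N0); first exact: leq_maxl.
apply: (Ld) Nd _; apply: (N0P (maxn i d)).
by apply: (Li i); [exact: leq_maxl|apply: (Ld) Lia; exact: leq_maxr].
Qed.

End SubgroupChains.

(** * Noetherianity of finitely generated Z[[phi]]-modules *)

Section Noetherian.
Variables (K : zmodType) (phi : {additive K -> K}).

(** Integer polynomials in [phi] of degree less than [d], applied to [r], modulo [B]; the
    coefficient [a] is the leading one. *)
Fixpoint upto (B : K -> Prop) (r : K) (d : nat) (x : K) : Prop :=
  if d is d'.+1 then
    exists a y, upto B r d' y /\ x = iter d' phi r *~ a + y
  else B x.

(** The Z[[phi]]-submodule generated by [gs], built one generator at a time so that Hilbert's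
    argument can proceed by induction on the list. *)
Fixpoint zspan (gs : seq K) (x : K) : Prop :=
  if gs is r :: gs' then exists d, upto (zspan gs') r d x else x = 0.

Lemma iter_raddf0 n : iter n phi 0 = 0.
Proof. by elim: n => //= n ->; rewrite raddf0. Qed.

Section Upto.
Variables (B : K -> Prop) (r : K).
Hypothesis B0 : B 0.
Hypothesis BB : forall x y, B x -> B y -> B (x - y).
Hypothesis Bphi : forall x, B x -> B (phi x).

Lemma upto0 d : upto B r d 0.
Proof. by elim: d => //= d IH; exists 0, 0; rewrite mulr0z addr0. Qed.

Lemma uptoB d x y : upto B r d x -> upto B r d y -> upto B r d (x - y).
Proof.
elim: d x y => [|d IH] x y /=; first exact: BB.
move=> [a [x' [xx' ->]]] [b [y' [yy' ->]]]; exists (a - b), (x' - y').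
by split; [exact: IH|rewrite mulrzBr opprD addrACA].
Qed.

Lemma uptoS d x : upto B r d x -> upto B r d.+1 x.
Proof. by move=> H; exists 0, x; rewrite mulr0z add0r. Qed.

Lemma upto_phi d x : upto B r d x -> upto B r d.+1 (phi x).
Proof.
elim: d x => [|d IH] x; first by move=> /Bphi; exact: (@uptoS 0%N).
by move=> [a [y [/IH yd ->]]]; exists a, (phi y); rewrite raddfD raddfMz.
Qed.

End Upto.

Lemma zspan_closed gs : [/\ zspan gs 0,
  forall x y, zspan gs x -> zspan gs y -> zspan gs (x - y) &
  forall x, zspan gs x -> zspan gs (phi x)].
Proof.
elim: gs => [|r gs [s0 sB sphi]] /=.
  by split=> [|x y -> ->|x ->]; rewrite ?subr0 ?raddf0.
have uS i j x : (i <= j)%N -> upto (zspan gs) r i x -> upto (zspan gs) r j x.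
  by apply: homo_chain => {}i {}x; exact: uptoS.
split; first by exists 0%N.
- move=> x y [d xd] [e ye]; exists (maxn d e); apply: uptoB => //.
    by apply: uS xd; exact: leq_maxl.
  by apply: uS ye; exact: leq_maxr.
- by move=> x [d xd]; exists d.+1; exact: upto_phi.
Qed.

Lemma zspan_mem gs r : r \in gs -> zspan gs r.
Proof.
elim: gs => [//|s gs IH]; have [s0 _ _] := zspan_closed gs.
rewrite inE => /predU1P[->|/IH rgs] /=; last by exists 0%N.
by exists 1%N, 1, 0; rewrite addr0.
Qed.

(* Hilbert's basis theorem for Z[t]-modules: in the step from gs to r :: gs, the
   leading coefficients of the elements of M i of degree d in r form a subgroup
   of Z, increasing in i and in d. *)
Lemma noetherian (M : nat -> K -> Prop) :
  (forall i, M i 0) -> (forall i x y, M i x -> M i y -> M i (x - y)) ->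
  (forall i x, M i x -> M i (phi x)) -> (forall i x, M i x -> M i.+1 x) ->
  forall gs, exists N, forall i x, zspan gs x -> M i x -> M N x.
Proof.
move=> M0 MB Mphi MS; have Mle i j x : (i <= j)%N -> M i x -> M j x.
  exact: homo_chain.
elim=> [|r gs [N0 IH]]; first by exists 0%N => i x ->.
have [s0 sB sphi] := zspan_closed gs.
pose L i d a := exists y, upto (zspan gs) r d y /\ M i (iter d phi r *~ a + y).
have [||||N1 N1P] := @int_chain2 L.
- by move=> i d; exists 0; rewrite mulr0z addr0; split=> //; exact: upto0.
- move=> i d a b [x [xd Mx]] [y [yd My]]; exists (x - y); split; first exact: uptoB.
  by rewrite mulrzBr addrACA -opprD; exact: MB.
- by move=> i d a [x [xd Mx]]; exists x; split=> //; exact: MS.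
- move=> i d a [x [xd Mx]]; exists (phi x); split; first exact: upto_phi.
  by have := Mphi _ _ Mx; rewrite raddfD raddfMz.
exists (maxn N0 N1) => i x [d xd] Mx.
elim: d i x xd Mx => [|d IHd] i x /=.
  by move=> /IH H /H; apply: Mle; exact: leq_maxl.
move=> [a [y [yd ->]]] Mx.
have [z [zd Mz]] : L (maxn N0 N1) d a.
  have [z [zd Mz]] : L N1 d a by apply: (N1P i); exists y.
  by exists z; split=> //; apply: Mle Mz; exact: leq_maxr.
set N := maxn N0 N1 in IHd Mz *.
(* The leading terms cancel, so the difference has lower degree and the induction on [d] applies to
   it at the larger index [maxn i N]. *)
have MyBz : M N (y - z).
  apply: (IHd (maxn i N)); first exact: uptoB.
  have -> : y - z = iter d phi r *~ a + y - (iter d phi r *~ a + z).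
    by rewrite opprD addrACA subrr add0r.
  by apply: MB; [apply: Mle Mx; exact: leq_maxl|apply: Mle Mz; exact: leq_maxr].
have -> : iter d phi r *~ a + y = iter d phi r *~ a + z - (0 - (y - z)).
  by rewrite sub0r opprK -addrA [z + _]addrC subrK.
by apply: (MB) => //; apply: (MB).
Qed.

End Noetherian.

Lemma leq_expn e m n : (m <= n)%N -> (m ^ e <= n ^ e)%N.
Proof. by case: e => // e; rewrite leq_exp2r. Qed.

(** * Sums of boundedly many elements of a list *)

Section BoundedSums.
Variable K : zmodType.

(** Enumeration by multisets rather than by words: either [g] does not occur, or one copy of it is
    removed. *)
Fixpoint sums (gs : seq K) : nat -> seq K :=
  if gs is g :: gs' then
    fix sumsg r :=
      if r is r'.+1 then sums gs' r ++ [seq g + x | x <- sumsg r'] else sums gs' 0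
  else fun=> [:: 0].

Definition nsum (gs : seq K) (r : nat) (x : K) : Prop :=
  exists s, [/\ {subset s <= gs}, (size s <= r)%N & x = \sum_(y <- s) y].

Lemma sums_cons g gs r x : x \in sums gs r -> x \in sums (g :: gs) r.
Proof. by case: r => [|r] //= H; rewrite mem_cat H. Qed.

Lemma sums_add g gs r x : x \in sums (g :: gs) r -> g + x \in sums (g :: gs) r.+1.
Proof. by move=> H /=; rewrite mem_cat map_f ?orbT. Qed.

Lemma nsum_sums gs r x : nsum gs r x -> x \in sums gs r.
Proof.
case=> s []; elim: gs r s x => [|g gs IH] r s x sgs sr ->.
  case: s sgs sr => [|y s] sgs _; first by rewrite big_nil inE.
  by have := sgs y (mem_head _ _).
pose c := count (pred1 g) s; pose s' := filter (predC1 g) s.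
have csr : (c + size s' <= r)%N.
  by rewrite size_filter (_ : predC1 g = predC (pred1 g)) // count_predC.
have -> : \sum_(y <- s) y = g *+ c + \sum_(y <- s') y.
  rewrite (bigID (pred1 g)) /= big_filter; congr (_ + _).
  rewrite (eq_bigr (fun=> g)) => [|y /eqP//].
  by rewrite big_const_seq iter_addr_0.
have H : \sum_(y <- s') y \in sums (g :: gs) (r - c).
  apply/sums_cons/(IH _ s') => //.
  - by move=> y; rewrite mem_filter /= => /andP[yg /sgs]; rewrite inE (negPf yg).
  - by lia.
have -> : r = (c + (r - c))%N by lia.
elim: c {csr} (r - c)%N H => [|c IHc] k H; first by rewrite add0r.
by rewrite mulrS -addrA addSn; apply/sums_add/IHc.
Qed.

(** The multiplicity of each generator takes at most [r.+1] values. This serves a fixed list [gs];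
    the exponential estimate below serves a list growing with [r]. *)
Lemma size_sums_poly gs r : (size (sums gs r) <= r.+1 ^ size gs)%N.
Proof.
elim: gs r => [|g gs IH] r //=.
elim: r => [|r IHr]; first by rewrite (leq_trans (IH 0%N)) // !exp1n.
rewrite size_cat size_map (leq_trans (leq_add (IH _) IHr)) //.
rewrite !expnS [X in (_ <= X)%N]mulSn leq_add2l leq_mul2l /=.
by rewrite leq_expn ?orbT.
Qed.

(* The generating function of the number of multisets of size at most r in a set
   of size q is (1 - z)^(- q - 1). *)
Lemma size_sums_exp (R : realFieldType) (z : R) gs r : 0 < z -> z < 1 ->
  (size (sums gs r))%:R * z ^+ r * (1 - z) ^+ size gs <= 1.
Proof.
move=> z0 z1; have z10 : 0 <= 1 - z by lra.
elim: gs r => [|g gs IH] r /=.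
  by rewrite mulr1 mul1r exprn_ile1 // ltW.
elim: r => [|r IHr].
  by rewrite exprS [(1 - z) * _]mulrC mulrA mulr_ile1 ?mulr_ge0 ?exprn_ge0 ?ler0n //; lra.
have {}IH := IH r.+1; rewrite size_cat size_map natrD.
move: IH IHr; rewrite !exprS; set u := _%:R; set v := _%:R.
set p := z ^+ r; set q := (1 - z) ^+ _ => IH IHr.
have -> : (u + v) * (z * p) * ((1 - z) * q) =
  (1 - z) * (u * (z * p) * q) + z * (v * p * ((1 - z) * q)) by ring.
by nra.
Qed.

Lemma nsum0 gs r : nsum gs r 0.
Proof. by exists [::]; rewrite big_nil. Qed.

Lemma nsum_mem gs r x : x \in gs -> (0 < r)%N -> nsum gs r x.
Proof.
move=> xgs r0; exists [:: x]; rewrite big_seq1; split=> //.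
by move=> y; rewrite inE => /eqP->.
Qed.

Lemma nsumD gs r r' x x' : nsum gs r x -> nsum gs r' x' -> nsum gs (r + r') (x + x').
Proof.
move=> [s [sgs sr ->]] [s' [sgs' sr' ->]]; exists (s ++ s'); split.
- by move=> y; rewrite mem_cat => /orP[/sgs|/sgs'].
- by rewrite size_cat leq_add.
- by rewrite big_cat.
Qed.

Lemma nsum_sub gs gs' r r' x : {subset gs <= gs'} -> (r <= r')%N ->
  nsum gs r x -> nsum gs' r' x.
Proof.
by move=> gg rr [s [sgs sr ->]]; exists s; split=> // [y /sgs/gg//|]; exact: leq_trans sr rr.
Qed.

Lemma nsum_map (f : {additive K -> K}) gs r x : nsum gs r x ->
  nsum (map f gs) r (f x).
Proof.
move=> [s [sgs sr ->]]; exists (map f s); rewrite size_map big_map raddf_sum.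
by split=> // y /mapP[z /sgs zgs ->]; exact: map_f.
Qed.

End BoundedSums.

(** * Iterates of an additive map *)

Section IteratedMorphism.
Variables (K : zmodType) (phi : {additive K -> K}).

Lemma iter_raddfB n x y : iter n phi (x - y) = iter n phi x - iter n phi y.
Proof. by elim: n => //= n ->; rewrite raddfB. Qed.

Lemma iter_raddfD n x y : iter n phi (x + y) = iter n phi x + iter n phi y.
Proof. by elim: n => //= n ->; rewrite raddfD. Qed.

End IteratedMorphism.

(** * Fixed points of powers of [phi], and codes modulo a power of [iterdiff J] *)

Section FixedSubgroups.
Variables (K : zmodType) (phi : {additive K -> K}).
Implicit Types (J a : nat).

Definition iterdiff J x := iter J phi x - x.

Lemma iterdiff_is_additive J : zmod_morphism (iterdiff J).
Proof. by move=> x y; rewrite /iterdiff iter_raddfB !opprD addrACA. Qed.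

HB.instance Definition _ J :=
  GRing.isZmodMorphism.Build K K (iterdiff J) (@iterdiff_is_additive J).

Lemma iterdiffC J n x : iterdiff J (iter n phi x) = iter n phi (iterdiff J x).
Proof. by rewrite /iterdiff iter_raddfB -!iterD addnC. Qed.

Lemma iter_iterdiffC J a n x :
  iter a (iterdiff J) (iter n phi x) = iter n phi (iter a (iterdiff J) x).
Proof. by elim: a => //= a ->; rewrite iterdiffC. Qed.

Lemma iterM_fix J q (x : K) : iter J phi x = x -> iter (J * q) phi x = x.
Proof. by move=> Jx; elim: q => [|q IH]; rewrite ?muln0 // mulnS iterD IH. Qed.

(* [a] is such that the kernels of the powers of [iterdiff J] are constant from [a] on,
   which forces its kernel to meet the image of its [a]-th power trivially. *)
Lemma fixed_stable (gs : seq K) : injective phi ->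
  (forall x, exists s, zspan phi gs (iter s phi x)) ->
  exists J a, [/\ (0 < J)%N,
    forall e x, (0 < e)%N -> iter e phi x = x -> iter J phi x = x &
    forall z, iterdiff J (iter a (iterdiff J) z) = 0 -> iter a (iterdiff J) z = 0].
Proof.
move=> phi_inj gen.
have iter_inj n : injective (iter n phi) by elim: n => //= n IH x y /phi_inj/IH.
(* Factorial exponents make the fixed subgroups an ascending chain, which still contains the fixed
   points of each power of [phi]. *)
have [||||N NP] := @noetherian K phi (fun n x => iter n`! phi x = x) _ _ _ _ gs.
- by move=> i; rewrite iter_raddf0.
- by move=> i x y xE yE; rewrite iter_raddfB xE yE.
- by move=> i x xE; rewrite -iterSr iterS xE.
- by move=> i x xE; rewrite factS mulnC iterM_fix.
pose J := N`!; exists J.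
have [||||a aP] := @noetherian K phi (fun n x => iter n (iterdiff J) x = 0) _ _ _ _ gs.
- by move=> i; rewrite iter_raddf0.
- by move=> i x y xE yE; rewrite iter_raddfB xE yE subrr.
- by move=> i x xE; rewrite (iter_iterdiffC J i 1) /= xE raddf0.
- by move=> i x /= ->; rewrite raddf0.
exists a; split; first exact: fact_gt0.
(* The [s]-th iterate carries [x] into the span, where the chain is constant; injectivity brings the
   equation back. *)
- move=> e x e0 xE; have [s xs] := gen x; apply: (iter_inj s).
  rewrite -iterD addnC iterD; apply: (NP e) => //.
  rewrite -iterD addnC iterD; congr iter.
  by case: e e0 xE => // e _ xE; rewrite factS iterM_fix.
- move=> z zE; have [s zs] := gen z; apply: (iter_inj s); rewrite iter_raddf0.
  rewrite -iter_iterdiffC; apply: (aP a.+1) => //.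
  by rewrite iter_iterdiffC iterS zE iter_raddf0.
Qed.

(** Binomial expansion of (1 + D)^q, with D = [iterdiff J], cut at D^a: the binomial coefficients
    below degree [a] add up to at most (q+1)^a. *)
Lemma iter_expand J q a x : exists b y,
  [/\ nsum [seq iter c (iterdiff J) x | c <- iota 0 a] (q.+1 ^ a) b &
      iter (J * q) phi x = b + iter a (iterdiff J) y].
Proof.
elim: q a => [|q IH] [|a].
- by exists 0, x; split; [exact: nsum0|rewrite muln0 add0r].
- exists x, 0; split; last by rewrite muln0 iter_raddf0 addr0.
  by apply: nsum_mem; rewrite ?exp1n //= inE eqxx.
- by exists 0, (iter (J * q.+1) phi x); split; [exact: nsum0|rewrite add0r].
have [b1 [y1 [H1 E1]]] := IH a.+1; have [b2 [y2 [H2 E2]]] := IH a.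
(* The power q+1 of 1 + D is its power q plus D times its power q; the first summand is expanded to
   order [a.+1], the second only to order [a]. *)
exists (b1 + iterdiff J b2), (y1 + y2); split; last first.
  rewrite mulnS iterD -[LHS](addrNK (iter (J * q) phi x)) -/(iterdiff J _) {1}E2 E1.
  by rewrite raddfD iter_raddfD /= addrC addrACA.
apply: (@nsum_sub _ _ _ (q.+1 ^ a.+1 + q.+1 ^ a)) _ (nsumD H1 _).
- by [].
- by rewrite !expnS -mulSnr leq_mul2l leq_expn ?orbT.
apply: nsum_sub (nsum_map (iterdiff J) H2) => // y.
rewrite -map_comp => /mapP[c]; rewrite mem_iota => /andP[_ ca] ->.
by apply/mapP; exists c.+1; rewrite // mem_iota.
Qed.

Section Code.
Variables (J a : nat) (gs : seq K).
Hypothesis J0 : (0 < J)%N.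

Definition uni_basis : seq K :=
  flatten [seq [seq iter c (iterdiff J) (iter i phi g) | c <- iota 0 a, i <- iota 0 J]
          | g <- gs].

(** The class of [x] modulo the image of the [a]-th power of [iterdiff J] has a representative among
    the sums of at most [W] elements of a finite list; for [W] polynomial in the radius, there are
    polynomially many codes. *)
Definition uni_code (W : nat) (x : K) : Prop :=
  exists b y, nsum uni_basis W b /\ x = b + iter a (iterdiff J) y.

Lemma uni_code0 W : uni_code W 0.
Proof. by exists 0, 0; rewrite iter_raddf0 addr0; split=> //; exact: nsum0. Qed.

Lemma uni_codeD W W' x x' : uni_code W x -> uni_code W' x' -> uni_code (W + W') (x + x').
Proof.
move=> [b [y [H ->]]] [b' [y' [H' ->]]]; exists (b + b'), (y + y').
by rewrite iter_raddfD addrACA; split=> //; exact: nsumD.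
Qed.

(** Division of [i] by [J] leaves one of finitely many elements to expand, and the quotient, at most
    [i], bounds the number of terms. *)
Lemma uni_code_gen W i g : g \in gs -> (i.+1 ^ a <= W)%N -> uni_code W (iter i phi g).
Proof.
move=> ggs iW; have [b [y [H E]]] := iter_expand J (i %/ J) a (iter (i %% J) phi g).
exists b, y; split; last by rewrite -E -iterD mulnC -divn_eq.
apply: nsum_sub H; last first.
  by apply: leq_trans iW; apply: leq_expn; rewrite ltnS leq_div.
move=> _ /mapP[c ca ->]; apply/flatten_mapP; exists g => //.
by apply/allpairsP; exists (c, i %% J)%N; split=> //=; rewrite mem_iota /= add0n ltn_mod.
Qed.

End Code.

End FixedSubgroups.

(** * Double counting *)

Section Counting.

(** The parts of [Z] attached to distinct [t] are disjoint and have at least [s] elements each. For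
    [s = 1] this counts the elements of [T] by codes in [Z]. *)
Lemma size_fibers (X Y : eqType) (P : X -> Y -> Prop) (s : nat) (T : seq X) (Z : seq Y) :
  uniq T ->
  (forall t, t \in T -> exists L, [/\ uniq L, (s <= size L)%N &
     forall z, z \in L -> z \in Z /\ P t z]) ->
  (forall t t' z, t \in T -> t' \in T -> P t z -> P t' z -> t = t') ->
  (s * size T <= size Z)%N.
Proof.
elim: T Z => [|t T IH] Z /=; first by rewrite muln0.
move=> /andP[tT uT] ex inj.
have [L [uL sL LP]] := ex t (mem_head _ _).
rewrite mulnS -(count_predC (mem L) Z) leq_add //.
  rewrite -size_filter (leq_trans sL) // uniq_leq_size // => z zL.
  by rewrite mem_filter /= zL; case: (LP z zL).
rewrite -size_filter; apply: IH => // [t' t'T|t1 t2 z t1T t2T]; last first.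
  by apply: inj; rewrite inE ?t1T ?t2T orbT.
have t'tT : t' \in t :: T by rewrite inE t'T orbT.
have [L' [uL' sL' LP']] := ex t' t'tT.
exists L'; split=> // z zL'; have [zZ zP] := LP' z zL'; split=> //.
rewrite mem_filter zZ andbT /=; apply: contra tT => zL; have [_ zP'] := LP z zL.
by rewrite (inj t t' z) // mem_head.
Qed.

Lemma size_le_fibers2 (X Y : eqType) (h : X -> Y) (s : seq X) :
  (forall v, (count (fun x => h x == v) s <= 2)%N) ->
  (size s <= 2 * size (undup (map h s)))%N.
Proof.
move=> H; rewrite -(size_map h) -(perm_size (perm_count_undup _)).
rewrite size_flatten /shape -map_comp mulnC.
elim: (undup _) => //= y u IH; rewrite mulSn leq_add //.
by rewrite size_nseq count_map; exact: H.
Qed.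

Lemma size_le_count3 (T : eqType) (a b c : pred T) (s : seq T) :
  (forall t, t \in s -> [|| a t, b t | c t]) ->
  (size s <= count a s + count b s + count c s)%N.
Proof.
elim: s => //= t s IH H.
have {}IH : (size s <= count a s + count b s + count c s)%N.
  by apply: IH => u us; apply: H; rewrite inE us orbT.
move: (H t (mem_head _ _)) IH; clear.
by case: (a t); case: (b t); case: (c t) => //=; lia.
Qed.

Definition ints (r : nat) : seq int := [seq i%:Z - r%:Z | i <- iota 0 (2 * r).+1].

Lemma mem_ints r (m : int) : (`|m| <= r)%N -> m \in ints r.
Proof.
move=> mr; apply/mapP; exists (absz (m + r%:Z)); last by lia.
by rewrite mem_iota; lia.
Qed.

Lemma size_ints r : size (ints r) = (2 * r).+1.
Proof. by rewrite size_map size_iota. Qed.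

End Counting.

(** * The group law and conjugacy *)

Section SemidirectProduct.
Variables (K : zmodType) (phi : {additive K -> K}) (psi : K -> K).
Hypotheses (phiK : cancel phi psi) (psiK : cancel psi phi).

Local Notation G := (K * int)%type.
Local Notation pw := (phipow phi psi).
Local Notation mul := (gmul phi psi).
Local Notation one := (gone K).
Local Notation "x ~~~ y" := (gconj phi psi x y) (at level 70).

Lemma phipowS m x : pw (1 + m) x = phi (pw m x).
Proof.
case: m => [n|[|n]]; [by []|by rewrite /= psiK|].
have -> : 1 + Negz n.+1 = Negz n by lia.
by rewrite /= psiK.
Qed.

Lemma phipowP m x : pw (- 1 + m) x = psi (pw m x).
Proof.
rewrite -[in RHS](addNKr 1 m).
have -> : - - 1 + (- 1 + m) = 1 + (- 1 + m) by lia.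
by rewrite phipowS phiK.
Qed.

Lemma phipow_nat n x : pw n%:Z x = iter n phi x. Proof. by []. Qed.

Lemma phipow_add m n x : pw (m + n) x = pw m (pw n x).
Proof.
elim/int_ind: m => [|m IH|m IH]; first by rewrite add0r.
- by rewrite intS -addrA !phipowS IH.
- have -> : - m.+1%:Z = - 1 + - m%:Z by lia.
  by rewrite -addrA !phipowP IH.
Qed.

Lemma phipowD m x y : pw m (x + y) = pw m x + pw m y.
Proof.
have psiD u v : psi (u + v) = psi u + psi v.
  by apply: (can_inj phiK); rewrite psiK raddfD !psiK.
case: m => n /=; first exact: iter_raddfD.
by elim: n => /= [|n IH]; rewrite ?IH psiD.
Qed.

Lemma phipow0 m : pw m 0 = 0.
Proof. by apply: (addrI (pw m 0)); rewrite -phipowD !addr0. Qed.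

Lemma gmulA x y z : mul x (mul y z) = mul (mul x y) z.
Proof. by rewrite /gmul /= phipowD phipow_add !addrA. Qed.

Lemma gmul1 x : mul x one = x.
Proof. by case: x => k m; rewrite /gmul /= phipow0 !addr0. Qed.

Lemma g1mul x : mul one x = x.
Proof. by case: x => k m; rewrite /gmul /= !add0r. Qed.

Definition ginv (x : G) : G := (pw (- x.2) (- x.1), - x.2).

Lemma gmulV x : mul x (ginv x) = one.
Proof. by rewrite /gmul /ginv /= -phipow_add !subrr. Qed.

Lemma gmulVl x : mul (ginv x) x = one.
Proof. by rewrite /gmul /ginv /= -phipowD addNr phipow0 addNr. Qed.

Lemma gconj_sym x y : x ~~~ y -> y ~~~ x.
Proof.
move=> [g E]; exists (ginv g).
have -> : y = mul (mul g x) (ginv g) by rewrite E -gmulA gmulV gmul1.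
by rewrite !gmulA gmulVl g1mul.
Qed.

Lemma gconj_trans x y z : x ~~~ y -> y ~~~ z -> x ~~~ z.
Proof.
by move=> [g E] [h F]; exists (mul h g); rewrite -gmulA E gmulA F gmulA.
Qed.

(** * Words, balls and rotations *)

Section Words.
Variable S : seq G.

Definition wprod (w : seq G) : G := foldr mul one w.

Lemma wprod_cat v w : wprod (v ++ w) = mul (wprod v) (wprod w).
Proof. by elim: v => [|s v IH] /=; rewrite ?g1mul // IH gmulA. Qed.

Lemma wprod_rcons w s : wprod (rcons w s) = mul (wprod w) s.
Proof. by rewrite -cats1 wprod_cat /= gmul1. Qed.

Lemma ballP g n : g \in ball phi psi S n <->
  exists w, [/\ {subset w <= S}, (size w <= n)%N & wprod w = g].
Proof.
elim: n g => [|n IH] g.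
  rewrite inE; split=> [/eqP->|[[|s w] [_ //= _ <-]]]; last by [].
  by exists [::].
rewrite /= mem_undup mem_cat; split=> [/orP[/IH[w [wS wn <-]]|]|].
- by exists w; split=> //; exact: leqW.
- case/allpairsP=> -[x s] /= [/IH[w [wS wn <-]] sS ->].
  exists (rcons w s); rewrite size_rcons wprod_rcons; split=> // y.
  by rewrite mem_rcons inE => /predU1P[->//|/wS].
- case=> w [+ + <-]; case/lastP: w => [|w s] wS wn.
    by apply/orP; left; apply/IH; exists [::].
  apply/orP; right; rewrite wprod_rcons; apply: allpairs_f.
    apply/IH; exists w; split=> //; last by rewrite size_rcons in wn.
    by move=> y yw; apply: wS; rewrite mem_rcons inE yw orbT.
  by apply: wS; rewrite mem_rcons mem_head.
Qed.

Lemma ball_uniq n : uniq (ball phi psi S n).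
Proof. by case: n => //= n; exact: undup_uniq. Qed.

Lemma ball_sub m n : (m <= n)%N -> {subset ball phi psi S m <= ball phi psi S n}.
Proof.
by move=> mn g /ballP[w [wS wm <-]]; apply/ballP; exists w; split=> //; exact: leq_trans mn.
Qed.

Lemma size_ball_le m n : (m <= n)%N ->
  (size (ball phi psi S m) <= size (ball phi psi S n))%N.
Proof. by move=> mn; apply: uniq_leq_size (ball_uniq m) (ball_sub mn). Qed.

Lemma size_ball_gt0 n : (0 < size (ball phi psi S n))%N.
Proof. by apply: leq_trans (size_ball_le (leq0n n)). Qed.

Lemma size_ball_add m n : (size (ball phi psi S (m + n)) <=
  size (ball phi psi S m) * size (ball phi psi S n))%N.
Proof.
rewrite -(size_allpairs mul); apply: uniq_leq_size (ball_uniq _) _ => g.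
case/ballP=> w [wS wmn <-]; rewrite -(cat_take_drop m w) wprod_cat.
apply: allpairs_f; apply/ballP.
- exists (take m w); split=> // [y /mem_take/wS//|].
  by rewrite size_take; case: ltnP => // /leq_trans-> //.
- exists (drop m w); split=> // [y /mem_drop/wS//|].
  by rewrite size_drop leq_subLR.
Qed.

(** For w = u v, the factor v conjugates u v into v u. *)
Lemma gconj_rot i w : wprod w ~~~ wprod (rot i w).
Proof.
exists (wprod (drop i w)).
by rewrite -{2}(cat_take_drop i w) /rot !wprod_cat gmulA.
Qed.

End Words.

(** * Words as walks of a cursor on the integers *)

Section Walks.
Variable Rs : seq K.
Local Notation S := (gens Rs).
Local Notation Ball := (ball phi psi S).

Definition pos (w : seq G) : int := (wprod w).2.

Lemma pos_cat v w : pos (v ++ w) = pos v + pos w.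
Proof. by rewrite /pos wprod_cat. Qed.

Lemma pos_rcons w s : pos (rcons w s) = pos w + s.2.
Proof. by rewrite /pos wprod_rcons. Qed.

Lemma gensP s : s \in S -> (`|s.2| <= 1)%N /\ (s.1 = 0 \/ s.1 \in Rs).
Proof.
rewrite mem_cat !inE => /orP[/mapP[r rR ->]|/orP[|]/eqP->] /=; split=> //; by auto.
Qed.

Lemma pos_take_succ w i : {subset w <= S} ->
  (`|pos (take i.+1 w) - pos (take i w)| <= 1)%N.
Proof.
move=> wS; have [iw|wi] := ltnP i (size w); last first.
  by rewrite !take_oversize ?subrr // ltnW.
rewrite (take_nth one iw) pos_rcons addrAC subrr add0r.
by case: (gensP (wS _ (mem_nth one iw))).
Qed.

Lemma abs_pos_le w : {subset w <= S} -> (`|pos w| <= size w)%N.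
Proof.
elim/last_ind: w => [//|w s IH] wS; rewrite pos_rcons size_rcons.
have wS' : {subset w <= S} by move=> y yw; apply: wS; rewrite mem_rcons inE yw orbT.
have sS : s \in S by apply: wS; rewrite mem_rcons mem_head.
have := IH wS'; have [] := gensP sS.
move: (pos w) s.2 => p q + _; clear; lia.
Qed.

Lemma ball_abs_snd n g : g \in Ball n -> (`|g.2| <= n)%N.
Proof. by case/ballP=> w [wS wn <-]; apply: leq_trans (abs_pos_le wS) wn. Qed.

(** The conjugates of the elements of [Rs] by the powers of t with exponent in [-E, E]. *)
Definition shifted_gens (E : nat) : seq K := [seq pw m g | g <- Rs, m <- ints E].

Lemma size_shifted_gens E : size (shifted_gens E) = (size Rs * (2 * E).+1)%N.
Proof. by rewrite size_allpairs size_ints. Qed.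

(** A letter from [Rs] read at position m contributes its conjugate by t^m to the K-part, and every
    position met is at most [E] in absolute value. *)
Lemma narrow_walk E w : {subset w <= S} ->
  (forall i, (i <= size w)%N -> (`|pos (take i w)| <= E)%N) ->
  nsum (shifted_gens E) (size w) (wprod w).1.
Proof.
elim/last_ind: w => [|w s IH] wS wE; first exact: nsum0.
have wS' : {subset w <= S} by move=> y yw; apply: wS; rewrite mem_rcons inE yw orbT.
rewrite wprod_rcons size_rcons -addn1; apply: nsumD.
  apply: IH => // i iw; have := wE i; rewrite size_rcons => /(_ (leqW iw)).
  by rewrite -cats1 takel_cat.
have sS : s \in S by apply: wS; rewrite mem_rcons mem_head.
have [_ [->|sR]] := gensP sS.
- by rewrite phipow0; exact: nsum0.
- apply: nsum_mem => //; apply/allpairsP; exists (s.1, (wprod w).2); split=> //.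
  apply: mem_ints.
  have := wE (size w); rewrite size_rcons => /(_ (leqnSn _)).
  by rewrite -cats1 take_size_cat.
Qed.

(** The positions lie in [-n, n], so the [n]-th iterate of [phi] brings all exponents into [0, 2n],
    where only nonnegative powers of [phi] act. *)
Lemma shifted_walk_ind (Q : nat -> K -> Prop) n :
  Q 0%N 0 -> (forall i x, Q i x -> Q i.+1 x) ->
  (forall i x g k, g \in Rs -> (k <= 2 * n)%N -> Q i x -> Q i.+1 (x + iter k phi g)) ->
  forall w, {subset w <= S} -> (size w <= n)%N -> Q (size w) (iter n phi (wprod w).1).
Proof.
move=> Q0 QS QD; elim/last_ind=> [|w s IH] wS wn; first by rewrite /= iter_raddf0.
have wS' : {subset w <= S} by move=> y yw; apply: wS; rewrite mem_rcons inE yw orbT.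
rewrite size_rcons in wn *.
have sS : s \in S by apply: wS; rewrite mem_rcons mem_head.
have {IH} := IH wS' (ltnW wn).
rewrite wprod_rcons /= iter_raddfD; have [_ [->|sR]] := gensP sS.
  by rewrite phipow0 iter_raddf0 addr0; exact: QS.
have pw_n := abs_pos_le wS'.
rewrite -[iter n phi (pw _ _)]phipow_nat -phipow_add.
have -> : n%:Z + (wprod w).2 = (absz (n%:Z + pos w))%:Z by rewrite /pos in pw_n *; lia.
by rewrite phipow_nat; apply: QD => //; lia.
Qed.

Lemma uni_code_walk J a n w : (0 < J)%N -> {subset w <= S} -> (size w <= n)%N ->
  uni_code phi J a Rs (size w * (2 * n).+1 ^ a) (iter n phi (wprod w).1).
Proof.
move=> J0; apply: (@shifted_walk_ind
  (fun i => uni_code phi J a Rs (i * (2 * n).+1 ^ a))) => [|i x ix|i x g k gR kn ix].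
- exact: uni_code0.
- by rewrite mulSnr -[x]addr0; apply: uni_codeD ix _; exact: uni_code0.
- by rewrite mulSnr; apply: uni_codeD ix _; apply: uni_code_gen => //; exact: leq_expn.
Qed.

Lemma zspan_walk n w : {subset w <= S} -> (size w <= n)%N ->
  zspan phi Rs (iter n phi (wprod w).1).
Proof.
have [s0 sB sphi] := zspan_closed phi Rs.
apply: (@shifted_walk_ind (fun=> zspan phi Rs)) => // i x g k gR _ ix.
rewrite -[iter k phi g]opprK; apply: (sB) => //; rewrite -sub0r; apply: (sB) => //.
by elim: k => [|k IH]; [exact: zspan_mem|exact: sphi].
Qed.

(** Discrete intermediate values: the cursor starts at 0 and moves by at most one per letter. *)
Lemma walk_hits w i j : {subset w <= S} -> (i <= size w)%N ->
  (j <= `|pos (take i w)|)%N ->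
  exists2 i', (i' <= i)%N & `|pos (take i' w)|%N = j.
Proof.
move=> wS; elim: i j => [|i IH] j iw jw.
  by exists 0%N => //; move: jw; rewrite take0 leqn0 => /eqP->.
have [jw'|jw'] := leqP j `|pos (take i w)|.
  by have [i' i'i <-] := IH j (ltnW iw) jw'; exists i' => //; exact: leqW.
by exists i.+1 => //; have := pos_take_succ i wS; lia.
Qed.

(* The last inequality makes the exponent of the complementary factor nonzero; among
   three equal rotations, one pair satisfies it. *)
Lemma equal_rotations w i i' : (i < i')%N -> (i' <= size w)%N ->
  wprod (rot i w) = wprod (rot i' w) -> {subset w <= S} ->
  pos (take i' w) != pos (take i w) -> pos (take i' w) - pos (take i w) != pos w ->
  exists x y, [/\ x \in Ball (size w)./2, y \in Ball (size w), x.2 != 0,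
    mul x y = mul y x & wprod w ~~~ mul x y].
Proof.
move=> ii' i'w E wS p1 p2.
pose u := take i w; pose v := drop i (take i' w); pose z := drop i' w.
have Eu : take i' w = u ++ v.
  by rewrite -{1}(cat_take_drop i (take i' w)) take_takel // ltnW.
have Ew : w = u ++ v ++ z by rewrite catA -Eu cat_take_drop.
have Ei : rot i w = v ++ z ++ u.
  by rewrite catA -[v ++ z](drop_size_cat _ (erefl (size u))) -Ew /rot;
     congr (_ ++ _); rewrite size_takel // (leq_trans (ltnW ii')).
have Ei' : rot i' w = z ++ u ++ v by rewrite /rot Eu.
(* The two rotations read v z u and z u v, so their equality says that v and z u commute. *)
pose X := wprod v; pose Y := wprod (z ++ u).
have XY : mul X Y = mul Y X.
  by rewrite -!wprod_cat -Ei E Ei' catA.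
have X0 : X.2 != 0.
  move: p1; rewrite Eu pos_cat -/u; apply: contra => /eqP.
  by rewrite -/(pos v) => ->; rewrite addr0.
have Y0 : Y.2 != 0.
  move: p2; rewrite Eu -/u Ew !pos_cat addrAC subrr add0r.
  have -> : Y.2 = pos z + pos u by rewrite -pos_cat.
  by apply: contra => /eqP H; apply/eqP; rewrite addrCA [pos u + _]addrC H addr0.
have vS : {subset v <= S} by move=> y yv; apply: wS; rewrite Ew !mem_cat yv orbT.
have zuS : {subset z ++ u <= S}.
  by move=> y; rewrite mem_cat => /orP[] yv; apply: wS; rewrite Ew !mem_cat yv ?orbT.
have sw : size w = (size v + size (z ++ u))%N by rewrite Ew !size_cat; lia.
have conj1 : wprod w ~~~ mul X Y by rewrite -wprod_cat -Ei; exact: gconj_rot.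
(* The lengths of the two factors add up to that of [w]; the one of length at most half is taken
   first. *)
have [vw|wv] := leqP (size v) (size w)./2.
- exists X, Y; split=> //; apply/ballP; [exists v|exists (z ++ u)] => //.
  by split=> //; rewrite sw leq_addl.
- exists Y, X; split=> //; last by rewrite -XY.
  + apply/ballP; exists (z ++ u); split=> //; move: wv; rewrite sw.
    by move: (size v) (size (z ++ u)); lia.
  + by apply/ballP; exists v; split=> //; rewrite sw leq_addr.
Qed.

(** A cursor leaving [-E, E] provides more than [E] rotations starting at different distances from
    0. If no value is taken three times, more than E/2 conjugates are distinct; otherwise three
    equal rotations yield commuting factors. *)
Lemma walk_trichotomy E r g : g \in Ball r ->
  [\/ nsum (shifted_gens E) r g.1 /\ (`|g.2| <= E)%N,
      exists L, [/\ uniq L, {subset L <= Ball r}, (E < 2 * size L)%N &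
                    forall z, z \in L -> g ~~~ z] |
      exists x y, [/\ x \in Ball r./2, y \in Ball r, x.2 != 0,
                      mul x y = mul y x & g ~~~ mul x y]].
Proof.
case/ballP=> w [wS wr <-].
have [wE|] := pselect (forall i, (i <= size w)%N -> (`|pos (take i w)| <= E)%N).
  apply: Or31; split; last by have := wE _ (leqnn _); rewrite take_size.
  by apply: nsum_sub (narrow_walk wS wE).
move/existsNP=> [i0 /not_implyP[i0w /negP]]; rewrite -ltnNge => Ei0.
pose ap i := `|pos (take i w)|%N.
pose P := [seq ap i | i <- iota 0 (size w).+1].
(* First visits: one index for each absolute position attained. *)
pose I := [seq i <- iota 0 (size w).+1 | i == index (ap i) P].
have Iw i : i \in I -> (i <= size w)%N.
  by rewrite mem_filter mem_iota => /and3P[_ _].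
have Iinj i j : i \in I -> j \in I -> ap i = ap j -> i = j.
  by rewrite !mem_filter => /andP[/eqP iE _] /andP[/eqP jE _] ij; rewrite iE ij -jE.
have sI : sorted ltn I by apply: sorted_filter (iota_ltn_sorted _ _); exact: ltn_trans.
have szI : (E < size I)%N.
  rewrite -(size_map ap) -[X in (X < _)%N]/(E.+1.-1) prednK //.
  rewrite -{1}(size_iota 0 E.+1); apply: uniq_leq_size (iota_uniq _ _) _ => j.
  rewrite mem_iota add0n ltnS => /= jE.
  have [i ii0 ij] := walk_hits wS i0w (leq_trans jE (ltnW Ei0)).
  have jP : j \in P.
    by apply/mapP; exists i => //; rewrite mem_iota /= add0n ltnS (leq_trans ii0).
  have := jP; rewrite -index_mem size_map size_iota => jidx.
  have apj : ap (index j P) = j.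
    by rewrite -[RHS](nth_index 0%N jP) (nth_map 0%N) ?size_iota // nth_iota.
  apply/mapP; exists (index j P) => //.
  by rewrite mem_filter apj eqxx mem_iota.
pose h i := wprod (rot i w).
have [H|] := pselect (forall v, (count (fun i => h i == v) I <= 2)%N).
  apply: Or32; exists (undup (map h I)); split; first exact: undup_uniq.
  - move=> z; rewrite mem_undup => /mapP[i iI ->]; apply/ballP; exists (rot i w).
    by split=> [y||//]; rewrite ?mem_rot ?size_rot //; exact: wS.
  - exact: leq_trans szI (size_le_fibers2 H).
  - by move=> z; rewrite mem_undup => /mapP[i iI ->]; exact: gconj_rot.
move/existsNP=> [v /negP]; rewrite -ltnNge -size_filter => Hv; apply: Or33.
have : sorted ltn [seq i <- I | h i == v] by apply: sorted_filter sI; exact: ltn_trans.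
have : {subset [seq i <- I | h i == v] <= I} by move=> i; rewrite mem_filter => /andP[].
have : all (fun i => h i == v) [seq i <- I | h i == v] by exact: filter_all.
case: [seq i <- I | h i == v] Hv => [|x [|y [|z s]]] //= _.
move=> /and4P[/eqP hx /eqP hy /eqP hz _] sub /and3P[xy yz _].
have xI : x \in I by apply: sub; rewrite !inE eqxx.
have yI : y \in I by apply: sub; rewrite !inE eqxx !orbT.
have zI : z \in I by apply: sub; rewrite !inE eqxx !orbT.
have posN i j : i \in I -> j \in I -> (i < j)%N -> pos (take j w) != pos (take i w).
  move=> iI jI ij; apply/eqP => p; have := Iinj i j iI jI; rewrite /ap p => /(_ erefl).
  by lia.
have fin j : j \in I -> (x < j)%N -> h j = v -> pos (take j w) - pos (take x w) != pos w ->
  exists x y, [/\ x \in Ball r./2, y \in Ball r, x.2 != 0,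
                      mul x y = mul y x & wprod w ~~~ mul x y].
  move=> jI xj hj pj.
  have [||X [Y [XB YB X0 XY C]]] := equal_rotations xj (Iw j jI) _ wS _ pj.
  - by rewrite -/(h x) -/(h j) hj.
  - exact: posN.
  exists X, Y; split=> //; first by apply: ball_sub XB; exact: half_leq.
  exact: ball_sub YB.
(* The displacements from [x] to [y] and from [x] to [z] differ, so at most one of them equals
   [pos w]. *)
have [yw|yw] := eqVneq (pos (take y w) - pos (take x w)) (pos w); last exact: (fin y).
apply: (fin z) => //; first exact: ltn_trans yz.
rewrite -yw; apply: contra (posN y z yI zI yz) => /eqP.
by move/addIr=> ->.
Qed.

(** * The count of the classes meeting a ball *)

Lemma phipow_fix m x : pw m x = x -> iter `|m|%N phi x = x.
Proof.
case: m => n // xE; rewrite -phipow_nat -[in LHS]xE -phipow_add.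
by have -> : `|Negz n|%N%:Z + Negz n = 0 by lia.
Qed.

(* In a class of the third kind of [walk_trichotomy], given [x], the element [y] of its
   centralizer is determined by its exponent and by its K-part up to an element fixed
   by a power of phi, and such elements are separated by [uni_code]. *)
Lemma num_classes_le : (forall g : G, exists n, g \in Ball n) ->
  exists (a : nat) (B : seq K), forall r E n, num_classes phi psi (Ball r) n ->
  exists n1 n2 n3, [/\ (n <= n1 + n2 + n3)%N,
    (n1 <= size (sums (shifted_gens E) r) * (2 * E).+1)%N,
    (E.+1 * n2 <= 2 * size (Ball r))%N &
    (n3 <= size (Ball r./2) * size (sums B (r * (2 * r).+1 ^ a)) * (2 * r).+1)%N].
Proof.
move=> gen; have [||J [a [J0 fixJ kerJ]]] := @fixed_stable K phi Rs.
- exact: can_inj phiK.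
- move=> x; have [n /ballP[w [wS wn E]]] := gen (x, 0); exists n.
  by rewrite -[x]/((x, 0 : int).1) -E; exact: zspan_walk.
exists a, (uni_basis phi J a Rs) => r E n [T [<- Tball Tinj _]].
have conj_refl x : x ~~~ x by exists one; rewrite g1mul gmul1.
have uT : uniq T.
  apply/(uniqP one) => i j iT jT ij; apply: Tinj => //.
  by rewrite ij; exact: conj_refl.
have Teq t t' : t \in T -> t' \in T -> t ~~~ t' -> t = t'.
  move=> tT t'T tt'; rewrite -(nth_index one tT) -(nth_index one t'T).
  by congr nth; apply: Tinj; rewrite ?index_mem ?nth_index.
pose P1 t := `[< nsum (shifted_gens E) r t.1 /\ (`|t.2| <= E)%N >].
pose P2 t := `[< exists L, [/\ uniq L, {subset L <= Ball r}, (E < 2 * size L)%N &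
                    forall z, z \in L -> t ~~~ z] >].
pose P3 t := `[< exists x y, [/\ x \in Ball r./2, y \in Ball r, x.2 != 0,
                      mul x y = mul y x & t ~~~ mul x y] >].
exists (count P1 T), (count P2 T), (count P3 T); split.
- apply: size_le_count3 => t /Tball /(walk_trichotomy E)[H|H|H].
  + by apply/or3P/Or31/asboolP.
  + by apply/or3P/Or32/asboolP.
  + by apply/or3P/Or33/asboolP.
- rewrite -size_ints -(size_allpairs pair) -size_filter -[X in (X <= _)%N]mul1n.
  apply: (size_fibers (P := fun t z => t = z)) => [|t|t t' z _ _ -> ->//].
    exact: filter_uniq.
  rewrite mem_filter => /andP[/asboolP[tn tE] _]; exists [:: t]; split=> // z.
  rewrite inE => /eqP->; split=> //; rewrite (surjective_pairing t).
  by apply: allpairs_f; [exact: nsum_sums|exact: mem_ints].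
(* Each list [L] has more than E/2 elements, hence at least [uphalf E.+1], and lists of different
   classes are disjoint. *)
- have H : (uphalf E.+1 * count P2 T <= size (Ball r))%N.
    rewrite -size_filter; apply: (size_fibers (P := fun t z => t ~~~ z)).
    + exact: filter_uniq.
    + move=> t; rewrite mem_filter => /andP[/asboolP[L [uL LB EL tL]] _].
      exists L; split=> // [|z zL]; first by lia.
      by split; [exact: LB|exact: tL].
    + move=> t t' z; rewrite !mem_filter => /andP[_ tT] /andP[_ t'T] tz t'z.
      by apply: Teq => //; apply: gconj_trans tz (gconj_sym t'z).
  have E2 : (E.+1 <= 2 * uphalf E.+1)%N by lia.
  by rewrite (leq_trans (leq_mul E2 (leqnn _))) // -mulnA leq_mul2l H.
- rewrite -size_ints -(size_allpairs pair) -(size_allpairs pair) -size_filter.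
  rewrite -[X in (X <= _)%N]mul1n.
  (* The triple [z] encodes the class: the short factor, a code for the K-part of [y] moved by the
     [r]-th iterate of [phi], and the exponent of [y]. *)
  pose P (t : G) (z : G * K * int) := exists y u, [/\ mul z.1.1 y = mul y z.1.1,
    z.1.1.2 != 0, iter r phi y.1 = z.1.2 + iter a (iterdiff phi J) u, y.2 = z.2 &
    t ~~~ mul z.1.1 y].
  apply: (size_fibers (P := P)); first exact: filter_uniq.
    move=> t; rewrite mem_filter => /andP[/asboolP[x [y [xB yB x0 xy txy]]] _].
    have /ballP[w [wS wr Ew]] := yB.
    have [b [u [bW Eu]]] := uni_code_walk a J0 wS wr.
    exists [:: (x, b, y.2)]; split=> // z; rewrite inE => /eqP->; split.
      apply: allpairs_f; last by apply/mem_ints/(ball_abs_snd yB).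
      apply: allpairs_f => //; apply: nsum_sums; apply: nsum_sub bW => //.
      by rewrite size_ints leq_mul2r wr orbT.
    by exists y, u; split; rewrite // -Eu Ew.
  move=> t t' [[x b] m]; rewrite !mem_filter => /andP[_ tT] /andP[_ t'T] [y [u]] /=.
  move=> [xy x0 yb ym txy] [y' [u' [xy' _ yb' ym' txy']]].
  suff yy : y = y'.
    by apply: Teq => //; apply: gconj_trans txy _; rewrite yy; exact: gconj_sym.
  (* As [y] and [y'] commute with [x] and have the same exponent, the difference is fixed by a
     nonzero power of [phi], hence by its [J]-th power. Its [r]-th iterate lies both in the kernel
     of [iterdiff J] and in the image of the [a]-th power, so it vanishes. *)
  have d0 : y.1 - y'.1 = 0.
    have fixd : iter `|x.2|%N phi (y.1 - y'.1) = y.1 - y'.1.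
      apply: phipow_fix; move: (congr1 fst xy) (congr1 fst xy'); rewrite /= ym ym'.
      rewrite -{1}(subrK y'.1 y.1) phipowD addrA [x.1 + pw _ (_ - _)]addrC -addrA.
      by move=> + E'; rewrite E' addrA => /addIr/(canRL (addrK _)).
    have {}fixd := fixJ _ _ _ fixd; rewrite absz_gt0 in fixd.
    have E' : iter r phi (y.1 - y'.1) = iter a (iterdiff phi J) (u - u').
      by rewrite !iter_raddfB yb yb' opprD addrACA subrr add0r.
    have phi_inj : injective phi by exact: can_inj phiK.
    have : iter r phi (y.1 - y'.1) = 0.
      rewrite E'; apply: kerJ; rewrite -E' iterdiffC /iterdiff fixd //.
      by rewrite subrr iter_raddf0.
    by elim: (r) => //= k IH /eqP; rewrite -[X in _ == X](raddf0 phi) => /eqP/phi_inj/IH.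
  by rewrite (surjective_pairing y) (surjective_pairing y') ym ym' -(subrK y'.1 y.1) d0 add0r.
Qed.

End Walks.
End SemidirectProduct.

(** * Exponential growth estimates *)

Section Growth.
Variable R : realType.
Implicit Types (theta c A : R).

Lemma root_gt1 theta p : 1 < theta -> exists2 eta : R, 1 < eta & eta ^+ p.+1 = theta.
Proof.
move=> t1; exists (expR (ln theta / p.+1%:R)).
  by rewrite expR_gt1 divr_gt0 ?ltr0n // ln_gt0.
by rewrite -expRM_natl mulrC divfK ?pnatr_eq0 // lnK // posrE (lt_trans ltr01).
Qed.

Lemma bernoulli (d : R) n : 0 <= d -> 1 + n%:R * d <= (1 + d) ^+ n.
Proof.
move=> d0; elim: n => [|n IH]; first by rewrite mul0r addr0.
have n0 : 0 <= n%:R :> R by rewrite ler0n.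
by rewrite exprS -natr1; nra.
Qed.

(** With eta the (p+1)-st root of [theta], Bernoulli bounds r+1 by C eta^r; in the (p+1)-st power of
    this, the spare factor r+1 absorbs all constants. The case [p = 0] yields a power of [theta]
    above any constant. *)
Lemma poly_le_exp theta A p : 1 < theta ->
  exists N, forall r, (N <= r)%N -> A * (2 * r).+1%:R ^+ p <= theta ^+ r.
Proof.
move=> t1; have [eta e1 eE] := root_gt1 p t1.
pose d := eta - 1; have d0 : 0 < d by rewrite subr_gt0.
pose C := 1 + d^-1; have C0 : 0 < C by rewrite addr_gt0 // invr_gt0.
have lin r : r.+1%:R <= C * eta ^+ r.
  have bern : 1 + r%:R * d <= eta ^+ r.
    by have := bernoulli r (ltW d0); rewrite [1 + d]addrC subrK.
  apply: le_trans (ler_wpM2l (ltW C0) bern).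
  have -> : C * (1 + r%:R * d) = r.+1%:R + (r%:R * d + d^-1).
    by rewrite -natr1 /C; field; rewrite gt_eqF.
  by rewrite lerDl addr_ge0 ?mulr_ge0 ?invr_ge0 ?(ltW d0).
pose D := `|A| * 2 ^+ p * C ^+ p.+1.
have D0 : 0 <= D by rewrite !mulr_ge0 ?exprn_ge0 // ltW.
exists (Num.bound D) => r Nr.
have Dr : D <= r.+1%:R.
  by apply: le_trans (ltW (archi_boundP D0)) _; rewrite ler_nat; exact: leqW.
have Cp : 0 < C ^+ p.+1 by exact: exprn_gt0.
rewrite -(ler_pM2l Cp); apply: (@le_trans _ _ (r.+1%:R ^+ p.+1)); last first.
  apply: le_trans (lerXn2r _ _ _ (lin r)) _; rewrite ?nnegrE ?ler0n //.
    by rewrite mulr_ge0 ?exprn_ge0 ?ltW // (lt_trans ltr01).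
  by rewrite exprMn -!exprM mulnC exprM eE.
have P0 : 0 <= r.+1%:R ^+ p :> R by rewrite exprn_ge0.
rewrite [X in _ <= X]exprS; apply: le_trans _ (ler_wpM2r P0 Dr).
have -> : D * r.+1%:R ^+ p = C ^+ p.+1 * (`|A| * (2 * r.+1%:R) ^+ p).
  by rewrite /D exprMn; ring.
apply: ler_wpM2l (ltW Cp) _ _ _.
have Q0 : 0 <= (2 * r).+1%:R ^+ p :> R by rewrite exprn_ge0.
apply: le_trans (ler_wpM2r Q0 (ler_norm A)) _.
apply: ler_wpM2l => //; apply: lerXn2r; rewrite ?nnegrE ?ler0n ?mulr_ge0 //.
by rewrite -natrM ler_nat; lia.
Qed.

(* [c] approximates, within the factor [theta], the supremum of the numbers whose powers
   are all dominated by [f]. *)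
Lemma growth_rate (f : nat -> nat) (c0 theta : R) : 1 < c0 -> 1 < theta ->
  (forall n, 0 < f n)%N -> (forall m n, (m <= n)%N -> (f m <= f n)%N) ->
  (forall m n, (f (m + n) <= f m * f n)%N) ->
  (exists N, forall n, (N <= n)%N -> c0 ^+ n <= (f n)%:R) ->
  exists c A, [/\ c0 <= c, 0 <= A, forall n, c ^+ n <= (f n)%:R &
                  forall n, (f n)%:R <= A * (c * theta) ^+ n].
Proof.
move=> c1 t1 f0 fmono fsub [N fN].
have c00 : 0 < c0 by lra.
have t0 : 0 < theta by lra.
have ct0 j : 0 <= c0 * theta ^+ j by rewrite mulr_ge0 ?exprn_ge0 // ltW.
pose X j := `[< forall n, (c0 * theta ^+ j) ^+ n <= (f n)%:R >].
(* The growth hypothesis holds only from [N] on: it is applied at [n.+1 * N.+1], submultiplicativity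
   bounds [f] there by a power of [f n.+1], and the root of order [N.+1] is taken. *)
have X0 : X 0%N.
  apply/asboolP => -[|n]; first by rewrite expr0 ler1n.
  have fM k : (f (n.+1 * k.+1) <= f n.+1 ^ k.+1)%N.
    elim: k => [|k IH]; first by rewrite muln1 expn1.
    by rewrite mulnS expnS (leq_trans (fsub _ _)) // leq_mul2l IH orbT.
  rewrite mulr1 -(@ler_pXn2r _ N.+1) ?nnegrE ?exprn_ge0 ?ler0n ?(ltW c00) //.
  rewrite -exprM (le_trans (fN _ _)) //; first by nia.
  by rewrite -natrX ler_nat.
have exX : exists j, ~~ X j.
  have [j /(_ j (leqnn _))] := poly_le_exp (f 1%N).+1%:R 0 t1.
  rewrite expr0 mulr1 => jt; exists j; apply/asboolP => /(_ 1%N).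
  rewrite expr1 => H; have : theta ^+ j <= c0 * theta ^+ j.
    by rewrite ler_peMl ?exprn_ge0 ?ltW.
  by move: jt; rewrite -natr1; lra.
(* The rate is [c0 * theta ^+ j] for the index [j] just before the first failure; the failure of the
   next one occurs at some [n0]. *)
case: (ex_minnP exX) => -[|j]; first by rewrite X0.
move=> Xj1 Xmin; have /asboolP Xj : X j.
  by apply: contraT => /Xmin; rewrite ltnn.
have c0c : c0 <= c0 * theta ^+ j by rewrite ler_peMr ?exprn_ege1 ?ltW.
move: Xj1 => /asboolP/existsNP[n0 /negP]; rewrite -ltNge exprSr mulrA.
move: (c0 * _) Xj c0c {ct0} => c Xj c0c fn0.
have ct1 : 1 <= c * theta by nra.
have n0_gt0 : (0 < n0)%N.
  by case: n0 fn0 => //; have := f0 0%N; rewrite expr0 -[1]/(1%:R) ltr_nat; lia.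
(* Submultiplicativity removes blocks of length [n0], each costing at most [(c * theta) ^+ n0]; the
   remainder, shorter than [n0], costs at most [f n0]. *)
exists c, (f n0)%:R; split=> // n; elim/ltn_ind: n => n IH.
have [n0n|nn0] := leqP n0 n; last first.
  apply: (@le_trans _ _ (f n0)%:R); first by rewrite ler_nat fmono // ltnW.
  by rewrite ler_peMr ?ler0n ?exprn_ege1.
have -> : n = (n0 + (n - n0))%N by rewrite subnKC.
apply: (@le_trans _ _ (f n0 * f (n - n0))%N%:R); first by rewrite ler_nat.
rewrite natrM exprD mulrCA; apply: ler_pM; rewrite ?ler0n ?(ltW fn0) //.
by apply: IH; lia.
Qed.

Lemma half_bounds r : (2 * r./2 <= r <= (2 * r./2).+1)%N.
Proof. by lia. Qed.

(** The numerical half of the argument: [f] stands for ball sizes, [sz1] for the number of sums from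
    narrow walks, [sz3] for the number of codes. For large [r], the first and third kinds each
    satisfy n r <= f r, and the second costs the constant 2M. *)
Lemma conjugacy_ratio_bound (f : nat -> nat) (num : nat -> nat -> Prop) (c0 : R)
  (sz1 : nat -> nat -> nat) (sz3 : nat -> nat) (b p : nat) :
  1 < c0 -> (forall n, 0 < f n)%N -> (forall m n, (m <= n)%N -> (f m <= f n)%N) ->
  (forall m n, (f (m + n) <= f m * f n)%N) ->
  (exists N, forall n, (N <= n)%N -> c0 ^+ n <= (f n)%:R) ->
  (forall (z : R) E r, 0 < z -> z < 1 ->
     (sz1 E r)%:R * z ^+ r * (1 - z) ^+ (b * (2 * E).+1) <= 1) ->
  (forall r, sz3 r <= (2 * r).+1 ^ p)%N ->
  (forall r E n, num r n -> exists n1 n2 n3, [/\ (n <= n1 + n2 + n3)%N,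
    (n1 <= sz1 E r * (2 * E).+1)%N, (E.+1 * n2 <= 2 * f r)%N &
    (n3 <= f r./2 * sz3 r * (2 * r).+1)%N]) ->
  exists (C : nat) N, forall r n, (N <= r)%N -> num r n -> (n * r <= C * f r)%N.
Proof.
move=> c1 f0 fmono fsub fexp sz1P sz3P numP.
(* A cube root of [c0]: narrow walks lose three factors [theta ^+ r], and commuting pairs lose three
   factors [theta ^+ h] with h = r/2; [c0 <= c] pays for both. *)
have [theta t1 tE] := root_gt1 2 c1; have t0 : 0 < theta by lra.
have [c [A [c0c A0 cf fA]]] := growth_rate c1 t1 f0 fmono fsub fexp.
have c_gt0 : 0 < c by lra.
pose z := theta^-1; have z0 : 0 < z by rewrite invr_gt0.
have z1 : z < 1 by rewrite invf_lt1.
have kz : 0 < 1 - z by lra.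
pose k := (1 - z)^-1; have k0 : 0 < k by rewrite invr_gt0.
(* [M] makes k^(2bE) at most theta^(ME), hence at most theta^r for E = r/M; the successor keeps [M]
   positive for the division. *)
have [M0 /(_ _ (leqnSn _))] := poly_le_exp (k ^+ (2 * b)) 0 t1.
set M := M0.+1; rewrite expr0 mulr1 => kM.
have [N1 N1P] := poly_le_exp (k ^+ b) 2 t1.
have [N3 N3P] := poly_le_exp (A * theta) (p + 2) t1.
exists (1 + 2 * M + 1)%N, (maxn N1 N3) => r n; rewrite geq_max => /andP[rN1 rN3] rn.
have [n1 [n2 [n3 [nn n1P n2P n3P]]]] := numP r (r %/ M)%N n rn.
set E := (r %/ M)%N in n1P n2P; have EM : (M * E <= r)%N by rewrite mulnC leq_trunc_div.
have Er : (E <= r)%N by exact: leq_div.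
have r0 : (r%:R : R) <= (2 * r).+1%:R by rewrite ler_nat; lia.
have B1 : (n1 * r <= f r)%N.
  have H1 : (sz1 E r)%:R <= theta ^+ r * k ^+ (b * (2 * E).+1).
    have := sz1P z E r z0 z1; rewrite -mulrA -ler_pdivlMr.
      by rewrite mul1r invfM /z -!exprVn invrK.
    by rewrite mulr_gt0 ?exprn_gt0.
  have H2 : k ^+ (b * (2 * E).+1) <= k ^+ b * theta ^+ r.
    rewrite mulnS exprD mulnA [(b * 2)%N]mulnC exprM.
    apply: ler_wpM2l; first by rewrite exprn_ge0 ?ltW.
    apply: (@le_trans _ _ (theta ^+ M ^+ E)).
      by apply: lerXn2r kM; rewrite nnegrE exprn_ge0 ?ltW.
    by rewrite -exprM ler_weXn2l ?(ltW t1).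
  have H3 : (n1 * r)%:R <= (sz1 E r)%:R * (2 * r).+1%:R ^+ 2 :> R.
    rewrite -natrX -natrM ler_nat (leq_trans (leq_mul n1P (leqnn r))) //.
    rewrite -mulnA leq_mul // expnS expn1.
    by apply: leq_mul; [rewrite ltnS leq_mul2l Er orbT|rewrite -(ler_nat R)].
  rewrite -(ler_nat R); apply: le_trans (cf r); apply: le_trans H3 _.
  apply: (@le_trans _ _ (theta ^+ r * (k ^+ b * theta ^+ r) * (2 * r).+1%:R ^+ 2)).
    apply: ler_wpM2r; first by rewrite exprn_ge0.
    by apply: le_trans H1 _; rewrite ler_pM2l ?exprn_gt0.
  apply: (@le_trans _ _ (theta ^+ r * theta ^+ r * theta ^+ r)); last first.
    rewrite -!exprMn; apply: lerXn2r; rewrite ?nnegrE ?mulr_ge0 ?(ltW t0) ?(ltW c_gt0) //.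
    by move: c0c; rewrite -tE !exprS expr0 mulr1 mulrA.
  have -> : theta ^+ r * (k ^+ b * theta ^+ r) * (2 * r).+1%:R ^+ 2 =
    theta ^+ r * theta ^+ r * (k ^+ b * (2 * r).+1%:R ^+ 2) by ring.
  by rewrite ler_pM2l ?mulr_gt0 ?exprn_gt0 //; exact: N1P.
have B2 : (n2 * r <= 2 * M * f r)%N.
  have rE : (r <= M * E.+1)%N by rewrite mulnC ltnW // ltn_ceil.
  rewrite (leq_trans (leq_mul (leqnn n2) rE)) // mulnCA [(2 * M)%N]mulnC -mulnA.
  by rewrite leq_mul2l [(n2 * _)%N]mulnC n2P orbT.
have B3 : (n3 * r <= f r)%N.
  have /andP[h2 hr] := half_bounds r; set h := r./2 in n3P h2 hr.
  have H3 : (n3 * r)%:R <= (f h)%:R * (2 * r).+1%:R ^+ (p + 2) :> R.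
    rewrite -natrX -natrM ler_nat (leq_trans (leq_mul n3P (leqnn r))) //.
    rewrite -!mulnA leq_mul2l expnD -mulnn; apply/orP; right.
    by apply: leq_mul (sz3P r) _; rewrite leq_mul2l -(ler_nat R) r0 orbT.
  rewrite -(ler_nat R); apply: le_trans H3 _.
  have P0 : 0 <= (2 * r).+1%:R ^+ (p + 2) :> R by rewrite exprn_ge0.
  apply: le_trans (ler_wpM2r P0 (fA h)) _.
  apply: le_trans (cf r); apply: (@le_trans _ _ (c ^+ (2 * h))); last first.
    by rewrite ler_weXn2l //; lra.
  have ch : (c * theta) ^+ h * theta ^+ (2 * h) <= c ^+ (2 * h).
    rewrite [X in _ <= X]exprM [X in _ * X]exprM -exprMn.
    apply: lerXn2r; rewrite ?nnegrE ?mulr_ge0 ?exprn_ge0 ?(ltW t0) ?(ltW c_gt0) //.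
    rewrite [c ^+ 2]expr2 -mulrA ler_pM2l // -exprS tE //.
  apply: le_trans ch; rewrite -mulrA mulrCA ler_pM2l; last first.
    by rewrite exprn_gt0 // mulr_gt0.
  (* The spare [theta] in the constant of [N3P] covers odd [r], where r = 2h + 1. *)
  rewrite -(ler_pM2l t0) mulrA [theta * A]mulrC -exprS.
  apply: le_trans (N3P r rN3) _; rewrite ler_weXn2l ?(ltW t1) //.
rewrite !mulnDl !mul1n; apply: leq_trans (leq_mul nn (leqnn r)) _.
by rewrite !mulnDl !leq_add.
Qed.

End Growth.

(** * The bound for the semidirect product *)

Unset Implicit Arguments.

Theorem theorem1p2 (R : realType) (K : zmodType)
  (phi : {additive K -> K}) (psi : K -> K)
  (phiK : cancel phi psi) (psiK : cancel psi phi)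
  (Rs : seq K)
  (Rsym : forall r, r \in Rs -> - r \in Rs)
  (Sgen : forall g : (K * int)%type, exists n : nat, g \in ball phi psi (gens Rs) n)
  (Gexp : exp_growth R phi psi (gens Rs)) :
  exists C : R, exists N : nat, forall (r : nat) (n : nat), (N <= r)%N ->
    num_classes phi psi (ball phi psi (gens Rs) r) n ->
    n%:R / (size (ball phi psi (gens Rs) r))%:R <= C * ln (r%:R : R) / r%:R.
Proof.
have [a [B classes]] := num_classes_le phiK psiK Sgen.
case: Gexp => c0 c01 fexp.
have [||||r|C [N CN]] := @conjugacy_ratio_bound R
  (fun n => size (ball phi psi (gens Rs) n)) _ c0
  (fun E r => size (sums (shifted_gens phi psi Rs E) r))
  (fun r => size (sums B (r * (2 * r).+1 ^ a)))
  (size Rs) (a.+1 * size B) c01 _ _ _ fexp _ _ classes.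
- by move=> n; apply: (size_ball_gt0 phiK psiK).
- by move=> m n; apply: (size_ball_le phiK psiK).
- by move=> m n; apply: (size_ball_add phiK psiK).
- by move=> z E r z0 z1; rewrite -(size_shifted_gens phi psi); exact: size_sums_exp.
(* The number of codes is polynomial since r (2r+1)^a + 1 <= (2r+1)^(a+1). *)
- apply: leq_trans (size_sums_poly _ _) _; rewrite expnM leq_expn //.
  have := expn_gt0 (2 * r).+1 a; rewrite expnS /=; clear; nia.
(* The ratio is at most C/r; for [r] at least 2, division of the constant by [ln 2] lets [ln r]
   enter. *)
have ln2 : 0 < ln (2 : R) by rewrite ln_gt0 // ltr1n.
exists (C%:R / ln 2), (maxn N 2) => r n; rewrite geq_max => /andP[Nr r2] rn.
have r0 : 0 < r%:R :> R by rewrite ltr0n ltnW.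
have f0 : 0 < (size (ball phi psi (gens Rs) r))%:R :> R.
  by rewrite ltr0n (size_ball_gt0 phiK psiK).
apply: (@le_trans _ _ (C%:R / r%:R)).
  by rewrite ler_pdivrMr // mulrAC ler_pdivlMr // -!natrM ler_nat CN.
rewrite ler_pM2r ?invr_gt0 // -mulrA -[X in X <= _]mulr1 ler_wpM2l ?ler0n //.
by rewrite mulrC ler_pdivlMr // mul1r ler_ln ?posrE // ler_nat.
Qed.
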